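(* Let $n\ge 0$ and $k\ge 1$ be integers. Let $A_{n,k}$ be the set of lattice paths of length $n$ which start at $(0,0)$, end on height $0$ or $-1$, and are contained in the strip $-\lfloor\frac{k+1}{2}\rfloor \leq y \leq \lfloor\frac{k}{2}\rfloor$. Let $B_{n,k}$ be the set of lattice paths of length $n$ which start at $(0,0)$ and are contained in the strip $0\leq y\leq k$ (with no condition on the final height). Then there is a bijection between $A_{n,k}$ and $B_{n,k}$.
   Context: A lattice path of length $n$ here is a sequence of $n$ steps starting at $(0,0)$, each step being either an up step $U:(i,j)\to(i+1,j+1)$ or a down step $D:(i,j)\to(i+1,j-1)$. The height of a point $(i,j)$ on the path is its ordinate $j$. A path is contained in a strip $a\le y\le b$ if all of its points have height between $a$ and $b$ (inclusive). *)

(* Defs.v *)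
From HB Require Import structures.
From mathcomp Require Import all_boot all_order all_algebra.
Set Implicit Arguments.
Unset Strict Implicit.
Unset Printing Implicit Defensive.
Import Order.TTheory GRing.Theory Num.Theory.
Local Open Scope ring_scope.

Inductive step := U | D.

Definition bool_of_step (s : step) : bool := if s is U then true else false.
Definition step_of_bool (b : bool) : step := if b then U else D.
Lemma bool_of_stepK : cancel bool_of_step step_of_bool.
Proof. by case. Qed.
HB.instance Definition _ := Finite.copy step (can_type bool_of_stepK).

Definition point := (int * int)%type.

Definition move (P : point) (s : step) : point :=
  match s with
  | U => (P.1 + 1, P.2 + 1)
  | D => (P.1 + 1, P.2 - 1)
  end.

Definition origin : point := (0, 0).

(* All the points visited by the path, starting point included. *)
Definition points (p : seq step) : seq point := origin :: scanl move origin p.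

Definition final_height (p : seq step) : int := (last origin (points p)).2.

Definition in_strip (a b : int) (p : seq step) : bool :=
  all (fun P : point => a <= P.2 <= b) (points p).

Definition A (n k : nat) : {set n.-tuple step} :=
  [set p : n.-tuple step |
     ((final_height p == 0) || (final_height p == -1))
     && in_strip (- (k.+1 %/ 2)%N%:Z) (k %/ 2)%N%:Z p].

Definition B (n k : nat) : {set n.-tuple step} :=
  [set p : n.-tuple step | in_strip 0 k%:Z p].

(* Main.v *)
Require Import Defs.
From HB Require Import structures.
From mathcomp Require Import all_boot all_order all_algebra.
From mathcomp Require Import zify.

(** A bijection exists because the two sets are equinumerous.  Raised by
    m = floor((k+1)/2), the strip of A becomes 0 <= y <= k.  Let N(i,j) be the
    number of walks of length n from height i to height j inside that strip.
    The claim reads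
<<
      N(m,m) + N(m,m-1) = N(0,0) + N(0,1) + ... + N(0,k).
>>
    Walks of length n+1 from i to j can be cut after the first step or before
    the last one; comparing both counts gives the discrete wave equation
<<
      N(i+1,j) + N(i-1,j) = N(i,j+1) + N(i,j-1)
>>
    at all heights i, j of the strip ([walks_wave]), where N vanishes as soon
    as an argument leaves the strip.  In the form
    N(i+1,j) - N(i,j-1) = N(i,j+1) - N(i-1,j) it says that a difference along
    a diagonal is unchanged when i decreases and j increases by one.  Once i
    has gone down to 0 the subtracted term N(-1,_) is zero, hence
    N(i+1,j+1) - N(i,j) = N(0,i+j+2) as long as i+j+2 <= k+1
    ([walks_diagonal]).  Telescoping from m down to 0 writes N(m,m) as the sum
    of the N(0,l) with l even, l <= 2m, and N(m,m-1) as the sum of those with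
    l odd, l < 2m ([walks_middle]).  Since 2m is k or k+1 and N(0,k+1) = 0,
    both together are the right-hand side. *)

Import Order.TTheory GRing.Theory Num.Theory.
Local Open Scope ring_scope.

Definition climb (h : int) (s : step) : int :=
  if s is U then h + 1 else h - 1.

Definition confined (a b h : int) (p : seq step) : bool :=
  all (fun y => a <= y <= b) (h :: scanl climb h p).

Lemma confined_cons a b h s p :
  confined a b h (s :: p) = (a <= h <= b) && confined a b (climb h s) p.
Proof. by []. Qed.

Lemma climbD c h s : climb (c + h) s = c + climb h s.
Proof. by case: s; rewrite /= addrA. Qed.

Lemma foldl_climbD c h p : foldl climb (c + h) p = c + foldl climb h p.
Proof. by elim: p h => //= s p IH h; rewrite climbD IH. Qed.

Lemma confinedD c a b h p :
  confined (c + a) (c + b) (c + h) p = confined a b h p.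
Proof.
elim: p h => [|s p IH] h; first by rewrite /confined /= !lerD2l.
by rewrite !confined_cons climbD IH !lerD2l.
Qed.

Lemma confined_last a b h p :
  confined a b h p -> a <= foldl climb h p <= b.
Proof.
elim: p h => [|s p IH] h; first by rewrite /confined /= andbT.
by rewrite confined_cons => /andP[_ /IH].
Qed.

Lemma snd_move (P : point) s : (move P s).2 = climb P.2 s.
Proof. by case: s. Qed.

Lemma in_strip_confined a b p : in_strip a b p = confined a b 0 p.
Proof.
rewrite /in_strip /confined /points -[X in _ = all _ (X :: _)]/(origin.2) /=.
rewrite -[X in scanl climb X]/(origin.2); congr (_ && _).
by elim: p origin => //= s p IH P; rewrite snd_move IH snd_move.
Qed.

Lemma final_height_foldl p : final_height p = foldl climb 0 p.
Proof.
rewrite /final_height /points /= -[X in foldl _ X]/(origin.2).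
by elim: p origin => //= s p IH P; rewrite IH snd_move.
Qed.

Lemma card_tuple_step n (P : pred (seq step)) :
  #|[set p : n.+1.-tuple step | P p]|
  = (#|[set p : n.-tuple step | P (U :: p)]|
     + #|[set p : n.-tuple step | P (D :: p)]|)%N.
Proof.
have cons_inj s : injective (fun p : n.-tuple step => [tuple of s :: p]).
  by move=> p q /(congr1 val) [] /val_inj.
rewrite -(card_imset _ (cons_inj U)) -(card_imset _ (cons_inj D)) -cardsUI.
rewrite [_ :&: _](_ : _ = set0) ?cards0 ?addn0; last first.
  apply/setP => p; rewrite !inE; apply/negP => /andP[/imsetP[q _ ->]].
  by case/imsetP=> r _ /(congr1 val).
apply: eq_card => p; rewrite !inE; apply/idP/orP.
  case/tupleP: p => -[] p Pp; [left|right]; apply/imsetP; exists p => //;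
  by rewrite inE.
by case=> /imsetP[q]; rewrite inE => Pq ->.
Qed.

Definition walks (k n : nat) (i j : int) : nat :=
  #|[set p : n.-tuple step | confined 0 k i p && (foldl climb i p == j)]|.

Lemma walks0 k i j : walks k 0 i j = ((0 <= i <= k%:Z) && (i == j)) :> nat.
Proof.
rewrite /walks; set b := _ && _.
rewrite (_ : [set _ | _] = if b then setT else set0).
  by case: b; rewrite ?cards0 // cardsT card_tuple expn0.
apply/setP=> p; rewrite (tuple0 p) !inE /confined /= andbT -/b.
by case: b; rewrite !inE.
Qed.

Lemma walksS k n i j : 0 <= i <= k%:Z ->
  walks k n.+1 i j = (walks k n (i + 1) j + walks k n (i - 1) j)%N.
Proof.
move=> ik; rewrite /walks (card_tuple_step n
  (fun p => confined 0 k%:Z i p && (foldl climb i p == j))).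
by congr (_ + _)%N; apply: eq_card => p; rewrite !inE confined_cons ik.
Qed.

Lemma walks_start_out k n i j : ~~ (0 <= i <= k%:Z) -> walks k n i j = 0%N.
Proof.
move=> ik; apply/eqP; rewrite cards_eq0 -subset0; apply/subsetP => p.
by rewrite !inE /confined /= (negbTE ik).
Qed.

Lemma walks_end_out k n i j : ~~ (0 <= j <= k%:Z) -> walks k n i j = 0%N.
Proof.
move=> jk; apply/eqP; rewrite cards_eq0 -subset0; apply/subsetP => p.
by rewrite !inE => /andP[/confined_last ik /eqP ij]; rewrite -ij ik in jk.
Qed.

(** Induction on the length: the start of a walk is exposed by [walksS] and its
    end by the induction hypothesis, and these two operations commute. *)
Lemma walksS_last k n i j : 0 <= j <= k%:Z ->
  walks k n.+1 i j = (walks k n i (j + 1) + walks k n i (j - 1))%N.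
Proof.
move=> jk; elim: n i => [|n IH] i.
  have [ik|ik] := boolP (0 <= i <= k%:Z); last by rewrite !walks_start_out.
  by rewrite walksS // !walks0; lia.
have [ik|ik] := boolP (0 <= i <= k%:Z); last by rewrite !walks_start_out.
by rewrite walksS // !IH !(walksS _ n i) // addnACA.
Qed.

Lemma walks_wave k n i j : 0 <= i <= k%:Z -> 0 <= j <= k%:Z ->
  (walks k n (i + 1) j + walks k n (i - 1) j
   = walks k n i (j + 1) + walks k n i (j - 1))%N.
Proof. by move=> ik jk; rewrite -walksS // -walksS_last. Qed.

(** Rewritten as a statement on diagonal differences, the wave equation carries
    the pair (i, j) to (i-1, j+1), until i = 0 where walks from height -1
    contribute nothing.  It is used at the points (i, j+1), (i-1, j+2), ...,
    (0, i+j+1), which the two bounds on j keep inside the strip.  The smallest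
    value j = -1 is the one that starts the odd diagonal in [walks_middle]. *)
Lemma walks_diagonal k n (i : nat) j : -1 <= j -> i%:Z + j + 1 <= k%:Z ->
  walks k n (i%:Z + 1) (j + 1)
  = (walks k n i%:Z j + walks k n 0 (i%:Z + j + 2))%N.
Proof.
elim: i j => [|i IH] j j1 ijk.
  have wave : (walks k n 1 (j + 1) + walks k n (0 - 1) (j + 1)
               = walks k n 0 (j + 1 + 1) + walks k n 0 (j + 1 - 1))%N.
    by apply: (walks_wave k n 0); lia.
  have e : 0%:Z + j + 2 = j + 1 + 1 by lia.
  by rewrite (walks_start_out _ _ (0 - 1)) // addn0 addrK addnC in wave; rewrite e add0r.
have wave := walks_wave k n (i%:Z + 1) (j + 1).
have {}IH := IH (j + 1).
have e1 : i.+1%:Z = i%:Z + 1 by lia.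
have e2 : i%:Z + (j + 1) + 2 = i%:Z + 1 + j + 2 by lia.
rewrite !addrK e2 in wave IH.
rewrite e1; apply: (@addnI (walks k n i%:Z (j + 1))).
rewrite addnC wave ?IH; lia.
Qed.

Lemma walks_middle k n m : (m.*2 <= k.+1)%N ->
  (walks k n m%:Z m%:Z + walks k n m%:Z (m%:Z - 1)
   = \sum_(l < m.*2.+1) walks k n 0 l%:Z)%N.
Proof.
elim: m => [_|m IH mk].
  (* The odd sum is empty here, and a walk cannot end at height -1. *)
  by rewrite big_ord1 [walks _ _ _ (0 - 1)]walks_end_out ?addn0.
have /IH {}IH : (m.*2 <= k.+1)%N by lia.
rewrite doubleS 2!big_ord_recr /= -IH.
(* One step on each of the two diagonals adds the terms 2m+2 and 2m+1. *)
have diag1 := walks_diagonal k n m m%:Z.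
have diag2 := walks_diagonal k n m (m%:Z - 1).
have e1 : m.+1%:Z = m%:Z + 1 by lia.
have e2 : m%:Z + (m%:Z - 1) + 2 = m.*2.+1%:Z by lia.
have e3 : m%:Z + m%:Z + 2 = m.*2.+2%:Z by lia.
rewrite e2 addrNK in diag2; rewrite e3 in diag1.
rewrite e1 addrK diag1 ?diag2; lia.
Qed.

(** Raising all heights by m turns the ends 0 and -1 into m and m-1; walks with
    distinct ends are counted separately. *)
Lemma card_A n k : #|A n k|
  = (walks k n (uphalf k)%:Z (uphalf k)%:Z
     + walks k n (uphalf k)%:Z ((uphalf k)%:Z - 1))%N.
Proof.
set m := uphalf k; rewrite /walks -cardsUI.
rewrite [_ :&: _](_ : _ = set0) ?cards0 ?addn0; last first.
  by apply/setP => p; rewrite !inE; lia.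
apply: eq_card => p; rewrite !inE in_strip_confined final_height_foldl.
rewrite -(confinedD m%:Z) -[in RHS](addr0 m%:Z) foldl_climbD.
have -> : m%:Z + - (k.+1 %/ 2)%N%:Z = 0 by rewrite /m; lia.
have -> : m%:Z + (k %/ 2)%N%:Z = k%:Z by rewrite /m; lia.
rewrite addr0 -andb_orr andbC; congr (_ && _).
by move: (foldl climb 0 p) => h; clearbody m; apply/idP/idP; lia.
Qed.

Lemma card_B n k : #|B n k| = (\sum_(l < k.+1) walks k n 0 l%:Z)%N.
Proof.
(* The cut-offs in inord and in the absolute value are harmless: a confined
   path ends at a height between 0 and k. *)
rewrite -sum1_card.
rewrite (partition_big (fun p : n.-tuple step => inord `|foldl climb 0 p|%N : 'I_k.+1)
  xpredT) //=.
apply: eq_bigr => l _; rewrite sum1dep_card; apply: eq_card => p.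
rewrite !inE in_strip_confined; apply: andb_id2l => /confined_last.
move: (foldl climb 0 p) => h /andP[h0 hk].
by rewrite -val_eqE /= inordK -?eqz_nat ?gez0_abs //; lia.
Qed.

Lemma card_A_eq_B n k : #|A n k| = #|B n k|.
Proof.
rewrite card_A card_B walks_middle; last by lia.
have [->|->] : (uphalf k).*2 = k \/ (uphalf k).*2 = k.+1 by lia.
  by [].
by rewrite big_ord_recr /= [walks _ _ _ k.+1%:Z]walks_end_out ?addn0 //; lia.
Qed.

Lemma card_eq_bijection (S T : finType) :
  #|S| = #|T| -> exists f : S -> T, bijective f.
Proof.
move=> eST; exists (enum_val \o cast_ord eST \o enum_rank).
exists (enum_val \o cast_ord (esym eST) \o enum_rank) => x /=.
  by rewrite enum_valK cast_ordK enum_rankK.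
by rewrite enum_valK cast_ordKV enum_rankK.
Qed.

Theorem theorem1p1 (n k : nat) (hk : (1 <= k)%N) :
  exists f : {p : n.-tuple step | p \in A n k} -> {p : n.-tuple step | p \in B n k},
    bijective f.
Proof.
by apply: card_eq_bijection; rewrite !card_sig card_A_eq_B.
Qed.
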